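(* If $L(T)$ is countable and $T$ has the SS-property, then for every model $M \models T$ and every countable substructure $N \subseteq M$, $N$ has a $T$-closure.
   Context: ''Submodel'' means (nonempty) substructure. $T$ has the SS-property iff (i) for all $M_1, M_2 \models T$ and substructures $N_1 \subseteq M_1$, $N_2 \subseteq M_2$, every isomorphism $f: N_1 \to N_2$ extends to an isomorphism $f^*: N_1^* \to N_2^*$ where $N_1^* \subseteq M_1$, $N_2^* \subseteq M_2$ are substructures that are models of $T$; and (ii) $T$ is model complete (for $N, M \models T$, $N \subseteq M$ implies $N \preceq M$). A $T$-closure of a structure $N$ is a model $N^* \models T$ with $N \subseteq N^*$ such that $N^*$ embeds over $N$ (fixing $N$ pointwise) into every model of $T$ containing $N$ as a substructure. *)

(* Defs.v *)
From mathcomp Require Import all_boot.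
From mathcomp Require Import all_classical.

Set Implicit Arguments.
Unset Strict Implicit.
Unset Printing Implicit Defensive.

Local Open Scope classical_set_scope.

(** * First-order logic with equality (one-sorted) *)

(* Constants are function symbols of arity 0. *)
Record language := Language {
  fsym : Type;
  rsym : Type;
  farity : fsym -> nat;
  rarity : rsym -> nat }.

Definition countable_language (L : language) : Prop :=
  countable [set: fsym L] /\ countable [set: rsym L].

Inductive term (L : language) : Type :=
| Var of nat
| App (f : fsym L) of ('I_(farity f) -> term L).

(* Variables are de Bruijn indices: [All phi] binds index 0 of [phi] and shifts
   the others by one.  The remaining connectives and the existential quantifier
   are the usual classical abbreviations. *)
Inductive formula (L : language) : Type :=
| Bot
| Eq of term L & term L
| Rel (r : rsym L) of ('I_(rarity r) -> term L)
| Imp of formula L & formula L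
| All of formula L.

Fixpoint term_bounded (L : language) (n : nat) (t : term L) : Prop :=
  match t with
  | Var m => m < n
  | App f a => forall i, term_bounded n (a i)
  end.

(* All free variables of [phi] have index < n. *)
Fixpoint formula_bounded (L : language) (n : nat) (phi : formula L) : Prop :=
  match phi with
  | Bot => True
  | Eq s t => term_bounded n s /\ term_bounded n t
  | Rel r a => forall i, term_bounded n (a i)
  | Imp p q => formula_bounded n p /\ formula_bounded n q
  | All p => formula_bounded n.+1 p
  end.

Record sentence (L : language) := Sentence {
  sentence_formula :> formula L;
  sentence_closed : formula_bounded 0 sentence_formula }.

Definition theory (L : language) := set (sentence L).

Record structure (L : language) := Structure {
  carrier :> Type;
  carrier_nonempty : inhabited carrier;
  finterp : forall f : fsym L, ('I_(farity f) -> carrier) -> carrier;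
  rinterp : forall r : rsym L, ('I_(rarity r) -> carrier) -> Prop }.

Definition scons (X : Type) (x : X) (v : nat -> X) : nat -> X :=
  fun n => if n is m.+1 then v m else x.

Fixpoint eval (L : language) (M : structure L) (v : nat -> M) (t : term L) : M :=
  match t with
  | Var n => v n
  | App f a => @finterp L M f (fun i => eval v (a i))
  end.

Fixpoint sat (L : language) (M : structure L) (v : nat -> M) (phi : formula L) :
    Prop :=
  match phi with
  | Bot => False
  | Eq s t => eval v s = eval v t
  | Rel r a => @rinterp L M r (fun i => eval v (a i))
  | Imp p q => sat v p -> sat v q
  | All p => forall x : M, sat (scons x v) p
  end.

Definition models (L : language) (M : structure L) (T : theory L) : Prop :=
  forall s : sentence L, T s -> forall v : nat -> M, sat v s.

(** * Embeddings, isomorphisms, substructures *)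

Definition is_embedding (L : language) (A B : structure L) (h : A -> B) : Prop :=
  [/\ injective h,
      forall (f : fsym L) (a : 'I_(farity f) -> A),
        h (finterp a) = finterp (fun i => h (a i)) &
      forall (r : rsym L) (a : 'I_(rarity r) -> A),
        rinterp a <-> rinterp (fun i => h (a i))].

Definition is_isomorphism (L : language) (A B : structure L) (h : A -> B) :
    Prop :=
  is_embedding h /\ bijective h.

Record substructure (L : language) (M : structure L) := Substructure {
  dom :> set M;
  dom_nonempty : dom !=set0;
  dom_closed : forall (f : fsym L) (a : 'I_(farity f) -> M),
    (forall i, dom (a i)) -> dom (finterp a) }.

Section Induced.
Variables (L : language) (M : structure L) (N : substructure M).

Lemma induced_nonempty : inhabited (set_type N).
Proof. by case: (dom_nonempty N) => x /mem_set Nx; exact: (inhabits (exist _ x Nx)). Qed.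

Definition induced_finterp (f : fsym L) (a : 'I_(farity f) -> set_type N) :
    set_type N :=
  exist _ (finterp (fun i => val (a i)))
    (mem_set (dom_closed (fun i => set_mem (valP (a i))))).

Definition induced_rinterp (r : rsym L) (a : 'I_(rarity r) -> set_type N) : Prop :=
  rinterp (fun i => val (a i)).

Definition induced : structure L :=
  Structure induced_nonempty induced_finterp induced_rinterp.

Definition incl (x : induced) : M := val x.

End Induced.

Definition elementary (L : language) (M : structure L) (N : substructure M) :
    Prop :=
  forall (phi : formula L) (v : nat -> induced N),
    sat v phi <-> sat (fun n => incl (v n)) phi.

(** * The SS-property and T-closures *)

Definition model_complete (L : language) (T : theory L) : Prop :=
  forall (M : structure L) (N : substructure M),
    models M T -> models (induced N) T -> elementary N.

(* To be used together with N1 `<=` N1'. *)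
Definition extends (L : language) (M1 M2 : structure L)
    (N1 N1' : substructure M1) (N2 N2' : substructure M2)
    (f : induced N1 -> induced N2) (f' : induced N1' -> induced N2') : Prop :=
  forall (x : induced N1) (y : induced N1'),
    incl x = incl y -> incl (f x) = incl (f' y).

Definition SS_property (L : language) (T : theory L) : Prop :=
  (forall M1 M2 : structure L, models M1 T -> models M2 T ->
   forall (N1 : substructure M1) (N2 : substructure M2)
          (f : induced N1 -> induced N2), is_isomorphism f ->
   exists (N1s : substructure M1) (N2s : substructure M2)
          (fs : induced N1s -> induced N2s),
     [/\ N1 `<=` N1s /\ N2 `<=` N2s,
         models (induced N1s) T /\ models (induced N2s) T,
         is_isomorphism fs &
         extends f fs])
  /\ model_complete T.

(* "N is a substructure of Ns" (resp. of M) is expressed by a given embedding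
   i (resp. j); "over N" then says that h commutes with these embeddings. *)
Definition is_T_closure (L : language) (T : theory L) (N Ns : structure L)
    (i : N -> Ns) : Prop :=
  [/\ models Ns T,
      is_embedding i &
      forall (M : structure L) (j : N -> M), models M T -> is_embedding j ->
        exists h : Ns -> M, is_embedding h /\ forall x : N, h (i x) = j x].

Definition has_T_closure (L : language) (T : theory L) (N : structure L) : Prop :=
  exists (Ns : structure L) (i : N -> Ns), is_T_closure T i.

(* Main.v *)
(* The SS-property makes any two models of T containing N share, up to
   isomorphism over N, a common submodel C that is elementary in both by model
   completeness.  Take M1 a countable model containing N.  Since there are only
   countably many types over N realized in M1, the omitting types theorem gives
   another model M2 containing N that omits all the non-isolated ones.  A type
   over N realized in the common C is realized both in M1 and in M2, hence is
   isolated; so C is a countable atomic model over N.  The types over N of C and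
   of any other model of T containing N agree, again by the SS-property, and a
   countable atomic model embeds into every structure of the same type. *)

Require Import Defs.
From mathcomp Require Import all_boot.
From mathcomp Require Import all_classical.

Set Implicit Arguments.
Unset Strict Implicit.
Unset Printing Implicit Defensive.

Local Open Scope classical_set_scope.

(** * Formulas, renaming and valuations *)

Arguments Var {L}.
Arguments Bot {L}.

Definition Not (L : language) (p : formula L) := Imp p Bot.
Definition And (L : language) (p q : formula L) := Not (Imp p (Not q)).
Definition Ex (L : language) (p : formula L) := Not (All (Not p)).

Lemma sat_And (L : language) (A : structure L) (v : nat -> A) p q :
  sat v (And p q) <-> sat v p /\ sat v q.
Proof.
split=> /= [npq|[vp vq] npq]; last exact: npq.
by split; apply: contrapT => nv; apply: npq => // vp vq; apply: nv.
Qed.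

Lemma sat_Ex (L : language) (A : structure L) (v : nat -> A) p :
  sat v (Ex p) <-> exists x, sat (scons x v) p.
Proof.
split=> /= [np|[x xp] np]; last exact: np xp.
by apply: contrapT => nex; apply: np => x xp; apply: nex; exists x.
Qed.

Fixpoint tren (L : language) (rho : nat -> nat) (t : term L) : term L :=
  match t with
  | Var n => Var (rho n)
  | App f a => App (fun i => tren rho (a i))
  end.

Fixpoint ren (L : language) (rho : nat -> nat) (phi : formula L) : formula L :=
  match phi with
  | Bot => Bot
  | Eq s t => Eq (tren rho s) (tren rho t)
  | Rel r a => Rel (fun i => tren rho (a i))
  | Imp p q => Imp (ren rho p) (ren rho q)
  | All p => All (ren (scons 0 (S \o rho)) p)
  end.

Lemma comp_scons (X Y : Type) (h : X -> Y) x v :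
  h \o scons x v = scons (h x) (h \o v).
Proof. by apply/funext => -[|n]. Qed.

Lemma eval_tren (L : language) (A : structure L) (v : nat -> A) rho t :
  eval v (tren rho t) = eval (v \o rho) t.
Proof.
elim: t => //= f a IH; congr finterp; apply/funext => i; exact: IH.
Qed.

Lemma sat_ren (L : language) (A : structure L) (v : nat -> A) rho phi :
  sat v (ren rho phi) <-> sat (v \o rho) phi.
Proof.
elim: phi v rho => //= [s t|r a|p IHp q IHq|p IH] v rho.
- by rewrite !eval_tren.
- by under eq_fun do rewrite eval_tren.
- by rewrite IHp IHq.
- have E x : scons x v \o scons 0 (S \o rho) = scons x (v \o rho).
    by rewrite comp_scons.
  by split=> H x; have := H x; rewrite IH E.
Qed.

Fixpoint tbound (L : language) (t : term L) : nat :=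
  match t with
  | Var n => n.+1
  | App f a => \max_i tbound (a i)
  end.

(** The quantifier case does not subtract one, so this is an upper bound, not the least one. *)
Fixpoint fbound (L : language) (phi : formula L) : nat :=
  match phi with
  | Bot => 0
  | Eq s t => maxn (tbound s) (tbound t)
  | Rel r a => \max_i tbound (a i)
  | Imp p q => maxn (fbound p) (fbound q)
  | All p => fbound p
  end.

Lemma tboundP (L : language) n (t : term L) : tbound t <= n -> term_bounded n t.
Proof.
elim: t => //= f a IH le_n i; apply: IH.
exact: leq_trans (@leq_bigmax _ (fun i => tbound (a i)) i) le_n.
Qed.

Lemma fboundP (L : language) n (phi : formula L) :
  fbound phi <= n -> formula_bounded n phi.
Proof.
elim: phi n => //= [s t|r a|p IHp q IHq|p IH] n.
- by rewrite geq_max => /andP[/tboundP ? /tboundP ?].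
- move=> le_n i; apply: tboundP.
  exact: leq_trans (@leq_bigmax _ (fun i => tbound (a i)) i) le_n.
- by rewrite geq_max => /andP[/IHp ? /IHq ?].
- by move=> /leqW /IH.
Qed.

Lemma eval_bounded (L : language) (A : structure L) n (v w : nat -> A) t :
  term_bounded n t -> (forall m, m < n -> v m = w m) -> eval v t = eval w t.
Proof.
elim: t => /= [m lt_m|f a IH bd] vw; first exact: vw.
by congr finterp; apply/funext => i; apply: IH.
Qed.

Lemma sat_bounded (L : language) (A : structure L) n (v w : nat -> A) phi :
  formula_bounded n phi -> (forall m, m < n -> v m = w m) ->
  sat v phi <-> sat w phi.
Proof.
elim: phi n v w => //= [s t|r a|p IHp q IHq|p IH] n v w.
- by move=> [bs bt] vw; rewrite (eval_bounded bs vw) (eval_bounded bt vw).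
- move=> bd vw; have -> // : (fun i => eval v (a i)) = (fun i => eval w (a i)).
  by apply/funext => i; exact: eval_bounded (bd i) vw.
- by move=> [bp bq] vw; rewrite (IHp _ _ _ bp vw) (IHq _ _ _ bq vw).
- move=> bp vw; have IH' x : sat (scons x v) p <-> sat (scons x w) p.
    by apply: (IH n.+1) => // -[|m] //=; rewrite ltnS => /vw.
  by split=> H x; apply/IH'.
Qed.

Lemma eq_sat (L : language) (A : structure L) (v w : nat -> A) phi :
  (forall m, m < fbound phi -> v m = w m) -> sat v phi <-> sat w phi.
Proof. by apply: sat_bounded; exact: fboundP. Qed.

(** Equality of complete types of infinite sequences, possibly in different structures. Applied to
    enumerations of parameters, it replaces the expansion of the language by constants. *)
Definition same_type (L : language) (A B : structure L) (v : nat -> A)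
    (w : nat -> B) :=
  forall phi, sat v phi <-> sat w phi.

(** Complete types are maximal: a formula failing at [v] transfers to [w] through its negation. *)
Lemma same_typeW (L : language) (A B : structure L) (v : nat -> A)
    (w : nat -> B) :
  (forall phi, sat v phi -> sat w phi) -> same_type v w.
Proof.
move=> vw phi; split=> [/vw//|wphi]; apply: contrapT => nv.
by have /vw/(_ wphi) : sat v (Not phi).
Qed.

Lemma same_type_sym (L : language) (A B : structure L) (v : nat -> A)
    (w : nat -> B) : same_type v w -> same_type w v.
Proof. by move=> vw phi; rewrite vw. Qed.

Lemma same_type_trans (L : language) (A B C : structure L) (v : nat -> B)
    (u : nat -> A) (w : nat -> C) :
  same_type u v -> same_type v w -> same_type u w.
Proof. by move=> uv vw phi; rewrite uv vw. Qed.

Lemma models_same_type (L : language) (T : theory L) (A B : structure L)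
    (v : nat -> A) (w : nat -> B) :
  same_type v w -> models A T -> models B T.
Proof.
move=> vw AT s Ts x.
by apply/(@sat_bounded _ _ 0 x w s (sentence_closed s)) => //; exact/vw/AT.
Qed.

(** * Finite tuples in front of a valuation *)

Definition prep (X : Type) (s : seq X) (v : nat -> X) : nat -> X :=
  foldr (@scons X) v s.

Lemma prep_lt (X : Type) x0 (s : seq X) v k :
  k < size s -> prep s v k = nth x0 s k.
Proof. by elim: s k => // x s IH [|k] //= /IH. Qed.

Lemma prep_ge (X : Type) (s : seq X) v k : prep s v (size s + k) = v k.
Proof. by elim: s. Qed.

Lemma comp_prep (X Y : Type) (h : X -> Y) s v :
  h \o prep s v = prep (map h s) (h \o v).
Proof. by elim: s => //= x s IH; rewrite comp_scons IH. Qed.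

Lemma sat_iter_Ex (L : language) (A : structure L) n (v : nat -> A) phi :
  sat v (iter n (@Ex L) phi) <->
  exists xs, size xs = n /\ sat (prep xs v) phi.
Proof.
elim: n phi => [|n IH] phi.
  by split=> [?|[xs [/size0nil->]]//]; exists [::].
rewrite iterSr IH; split=> [[xs [sxs /sat_Ex[x xP]]]|[[|x xs] [// [sxs] xP]]].
  by exists (x :: xs); split=> //=; rewrite sxs.
by exists xs; split=> //; apply/sat_Ex; exists x.
Qed.

Fixpoint eqs (L : language) (ks js : seq nat) : formula L :=
  match ks, js with
  | k :: ks', j :: js' => And (Eq (Var k) (Var j)) (eqs L ks' js')
  | _, _ => Not Bot
  end.

Lemma sat_eqs (L : language) (A : structure L) (v : nat -> A) ks js :
  size ks = size js -> sat v (eqs L ks js) <-> map v ks = map v js.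
Proof.
elim: ks js => [|k ks IH] [|j js] //; first by move=> _; split=> [_|_ []].
move=> /succn_inj/IH vE; rewrite [eqs _ _ _]/= sat_And vE.
split=> /= [[-> ->] //|E].
by case: E.
Qed.

(** * Countability of the set of formulas *)

Fixpoint tcode (L : language) (cf : Defs.fsym L -> nat) (t : term L) :
    GenTree.tree nat :=
  match t with
  | Var n => GenTree.Leaf n
  | App f a =>
      GenTree.Node (cf f) [seq tcode cf (a i) | i <- enum 'I_(farity f)]
  end.

(** The labels 0 to 3 mark the other constructors, so relation symbols are shifted by four. *)
Fixpoint fcode (L : language) (cf : Defs.fsym L -> nat) (cr : rsym L -> nat)
    (phi : formula L) : GenTree.tree nat :=
  match phi with
  | Bot => GenTree.Node 0 [::]
  | Eq s t => GenTree.Node 1 [:: tcode cf s; tcode cf t]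
  | Rel r a => GenTree.Node (cr r).+4
      [seq tcode cf (a i) | i <- enum 'I_(rarity r)]
  | Imp p q => GenTree.Node 2 [:: fcode cf cr p; fcode cf cr q]
  | All p => GenTree.Node 3 [:: fcode cf cr p]
  end.

Lemma eq_map_enum (n : nat) (X : Type) (f g : 'I_n -> X) :
  map f (enum 'I_n) = map g (enum 'I_n) -> f =1 g.
Proof.
move=> fg i; have E (h : 'I_n -> X) : nth (f i) (map h (enum 'I_n)) i = h i.
  by rewrite (nth_map i) ?size_enum_ord// nth_ord_enum.
by rewrite -[LHS]E fg E.
Qed.

Lemma tcode_inj (L : language) (cf : Defs.fsym L -> nat) :
  injective cf -> injective (tcode cf).
Proof.
move=> cf_inj; elim=> [n|f a IH] [m|g b] //= [].
  by move=> ->.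
move=> /cf_inj fg; subst g => /eq_map_enum ab.
by congr App; apply/funext => i; apply: IH.
Qed.

Lemma fcode_inj (L : language) (cf : Defs.fsym L -> nat) (cr : rsym L -> nat) :
  injective cf -> injective cr -> injective (fcode cf cr).
Proof.
move=> cf_inj cr_inj; have tc := tcode_inj cf_inj.
elim=> [|s t|r a|p IHp q IHq|p IH] [|s' t'|r' a'|p' q'|p'] //= [].
- by move=> /tc -> /tc ->.
- move=> /cr_inj rr; subst r' => /eq_map_enum aa.
  by congr Rel; apply/funext => i; apply: tc.
- by move=> /IHp -> /IHq ->.
- by move=> /IH ->.
Qed.

Lemma formula_code (L : language) :
  countable_language L -> exists c : formula L -> nat, injective c.
Proof.
move=> [/countable_injP[cf cf_inj] /countable_injP[cr cr_inj]].
exists (pickle \o fcode cf cr); apply: inj_comp; first exact: pcan_inj pickleK.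
by apply: fcode_inj => x y; [apply: cf_inj | apply: cr_inj]; rewrite inE.
Qed.

(** * Elementary maps and amalgamation *)

Definition is_elementary_map (L : language) (A B : structure L) (h : A -> B) :=
  forall v : nat -> A, same_type v (h \o v).

Lemma eval_embedding (L : language) (A B : structure L) (h : A -> B) v t :
  is_embedding h -> h (eval v t) = eval (h \o v) t.
Proof.
move=> [_ hf _]; elim: t => //= f a IH; rewrite hf.
by congr finterp; apply/funext => i; exact: IH.
Qed.

Lemma embedding_id (L : language) (A : structure L) : is_embedding (@id A).
Proof. by split. Qed.

Lemma embedding_comp (L : language) (A B C : structure L) (g : B -> C)
    (h : A -> B) :
  is_embedding g -> is_embedding h -> is_embedding (g \o h).
Proof.
move=> [gi gf gr] [hi hf hr]; split; first exact: inj_comp.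
  by move=> f a /=; rewrite hf gf.
by move=> r a; rewrite hr gr.
Qed.

Lemma embedding_cancel (L : language) (A B C : structure L) (g : B -> C)
    (h : A -> B) :
  is_embedding g -> is_embedding (g \o h) -> is_embedding h.
Proof.
move=> [gi gf gr] [ghi ghf ghr]; split; first exact: inj_compr ghi.
  by move=> f a; apply: gi; rewrite gf; exact: ghf.
by move=> r a; rewrite gr; exact: ghr.
Qed.

Lemma embedding_incl (L : language) (A : structure L) (N : substructure A) :
  is_embedding (@Defs.incl L A N).
Proof. by split=> //; exact: val_inj. Qed.

Lemma iso_inverse (L : language) (A B : structure L) (h : A -> B) :
  is_isomorphism h -> exists g : B -> A, is_isomorphism g /\ cancel h g.
Proof.
move=> [he [g hK gK]]; exists g; split=> //; split; last by exists h.
apply: (embedding_cancel he); have -> : h \o g = id by apply/funext.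
exact: embedding_id.
Qed.

Lemma iso_elementary (L : language) (A B : structure L) (h : A -> B) :
  is_isomorphism h -> is_elementary_map h.
Proof.
move=> [he [g hK gK]] v phi; have [hi _ hr] := he.
elim: phi v => //= [s t|r a|p IHp q IHq|p IH] v.
- by rewrite -!eval_embedding//; split=> [->|/hi].
- rewrite hr; have -> // : (fun i => h (eval v (a i))) =
    (fun i => eval (h \o v) (a i)).
  by apply/funext => i; rewrite eval_embedding.
- by rewrite IHp IHq.
- split=> H x; last by apply/IH; rewrite comp_scons; exact: H.
  by rewrite -(gK x) -comp_scons; apply/IH/H.
Qed.

Lemma elementary_map_inj (L : language) (A B : structure L) (h : A -> B) :
  is_elementary_map h -> injective h.
Proof.
move=> hE x y hxy.
by apply/(hE (scons x (fun=> y)) (Eq (Var 0) (Var 1))).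
Qed.

(** * Images of embeddings *)

Section Image.
Variables (L : language) (A B : structure L) (h : A -> B).
Hypothesis h_emb : is_embedding h.

Lemma image_closed (f : Defs.fsym L) (a : 'I_(farity f) -> B) :
  (forall i, range h (a i)) -> range h (finterp a).
Proof.
move=> /(_ _)/cid2-/all_sig[x xP]; exists (finterp x) => //.
have [_ -> _] := h_emb.
by congr finterp; apply/funext => i; case: (xP i).
Qed.

Lemma image_nonempty : range h !=set0.
Proof. by have [x] := carrier_nonempty A; exists (h x), x. Qed.

Definition image_sub : substructure B :=
  Substructure image_nonempty image_closed.

(** Links abstract embeddings, used for closures, to isomorphisms of substructures, used in the
    SS-property. *)
Lemma corestrict_iso : exists k : A -> induced image_sub,
  is_isomorphism k /\ forall x, Defs.incl (k x) = h x.
Proof.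
have hP x : h x \in (image_sub : set B) by apply/mem_set; exists x.
exists (fun x => exist _ (h x) (hP x)); split=> //; split.
  apply: (embedding_cancel (@embedding_incl _ _ image_sub)); exact: h_emb.
have /(_ _)/cid2-/all_sig[g gP] (y : induced image_sub) : range h (val y).
  exact: set_mem (valP y).
have [hi _ _] := h_emb.
exists g => [x|y]; first by apply: hi; case: (gP (exist _ (h x) (hP x))).
by apply: val_inj; case: (gP y).
Qed.

End Image.

(** The images of [i] and [j] are isomorphic; the SS-property extends this isomorphism to some [f]
    between submodels [N1] of [A] and [N2] of [B]. Take [C] to be [N1], with its inclusion into [A]
    and [f] into [B]; both are elementary by model completeness. *)
Lemma SS_amalgam (L : language) (T : theory L) (N A B : structure L)
    (i : N -> A) (j : N -> B) :
  SS_property T -> models A T -> models B T -> is_embedding i ->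
  is_embedding j ->
  exists (C : structure L) (c : N -> C) (a : C -> A) (b : C -> B),
    [/\ models C T, is_embedding c /\ is_elementary_map a,
        is_elementary_map b, a \o c = i & b \o c = j].
Proof.
move=> [SS MC] AT BT ie je.
have [ki [ki_iso kiE]] := corestrict_iso ie.
have [kj [kj_iso kjE]] := corestrict_iso je.
have [g [[ge gb] kiK]] := iso_inverse ki_iso.
have f_iso : is_isomorphism (kj \o g).
  by have [kje kjb] := kj_iso; split; [exact: embedding_comp|exact: bij_comp].
have [N1 [N2 [f [[sub1 _] [N1T N2T] f_isos fE]]]] := SS _ _ AT BT _ _ _ f_iso.
have iP x : i x \in (N1 : set A) by apply/mem_set/sub1; exists x.
exists (induced N1), (fun x => exist _ (i x) (iP x)), (@Defs.incl _ _ N1),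
  (@Defs.incl _ _ N2 \o f).
split=> //.
- split; last by move=> v phi; exact: (MC _ _ AT N1T).
  exact: (embedding_cancel (@embedding_incl _ _ N1)).
- move=> v phi; rewrite (iso_elementary f_isos v phi).
  exact: (MC _ _ BT N2T phi (f \o v)).
- apply/funext => x /=; rewrite -(fE (ki x)); last by rewrite kiE.
  by rewrite /= kiK kjE.
Qed.

(** The method of diagrams: send [v n] to [w n]. Agreement on equations gives well-definedness,
    injectivity and compatibility with functions, since each function value is again some [v n]. *)
Lemma diagram_embedding (L : language) (A B : structure L) (v : nat -> A)
    (w : nat -> B) :
  (forall x, exists n, v n = x) ->
  (forall s t, eval v s = eval v t <-> eval w s = eval w t) ->
  (forall r a, sat v (@Rel L r a) <-> sat w (@Rel L r a)) ->
  exists h : A -> B, is_embedding h /\ h \o v = w.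
Proof.
move=> /(_ _)/cid-/all_sig[k kP] eqP relP.
have vk (m : nat) (a : 'I_m -> A) : (fun i => v (k (a i))) = a.
  by apply/funext => i; rewrite kP.
exists (w \o k); split; last first.
  by apply/funext => n /=; apply/(eqP (Var _) (Var _)); rewrite /= kP.
split=> [x y|f a|r a].
- by move=> /(eqP (Var _) (Var _)) /=; rewrite !kP.
- have /= := eqP (Var (k (finterp a))) (App (fun i => Var (k (a i)))).
  by rewrite kP vk => -[+ _]; apply.
- by have /= := relP r (fun i => Var (k (a i))); rewrite vk.
Qed.

(** * Atomic structures *)

(* With [n := size t], the variables below [n] of [theta] refer to the tuple [t]
   and the variable [n + i] to the parameter [e i], so types of tuples over the
   range of [e] need no expansion of the language. *)
Definition isolated (L : language) (A : structure L) (e : nat -> A)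
    (t : seq A) :=
  exists theta, sat (prep t e) theta /\
    forall t', size t' = size t -> sat (prep t' e) theta ->
    same_type (prep t e) (prep t' e).

(** The same [theta] isolates in [A]: every competing tuple of [A] maps to one of [B], where the
    isolation is known. *)
Lemma isolated_elementary (L : language) (A B : structure L) (h : A -> B)
    (e : nat -> A) (t : seq A) :
  is_elementary_map h -> isolated (h \o e) (map h t) -> isolated e t.
Proof.
move=> hE [theta [tP tI]]; exists theta; split.
  by apply/hE; rewrite comp_prep.
move=> t' st' /hE; rewrite comp_prep => t'P phi.
rewrite (hE (prep t e) phi) (hE (prep t' e) phi) !comp_prep.
by apply: (tI (map h t')) => //; rewrite !size_map.
Qed.

Definition atomic_over (L : language) (A : structure L) (e : nat -> A) :=
  forall t, isolated e t.

(** The newest entry comes first, so that extending the tuple is a [scons] of valuations. *)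
Fixpoint tup (X : Type) (g : nat -> X) n : seq X :=
  if n is m.+1 then g m :: tup g m else [::].

Lemma size_tup (X : Type) (g : nat -> X) n : size (tup g n) = n.
Proof. by elim: n => //= n ->. Qed.

Lemma prep_tup (X : Type) (g e : nat -> X) n k :
  k < n -> prep (tup g n) e (n - k.+1) = g k.
Proof.
elim: n => // n IH; rewrite ltnS leq_eqVlt => /predU1P[->|kn].
  by rewrite subnn.
by rewrite subSn//= IH.
Qed.

(** If [theta] isolates the type of [x :: t], its existential closure in the first variable provides
    [y], and for each [phi] in that type the formula stating that [theta] implies [phi] for all
    values of this variable transfers too. *)
Lemma atomic_step (L : language) (A B : structure L) (e : nat -> A)
    (e' : nat -> B) t t' x :
  atomic_over e -> same_type (prep t e) (prep t' e') ->
  exists y, same_type (prep (x :: t) e) (prep (y :: t') e').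
Proof.
move=> at_e tt'; have [theta [xP xI]] := at_e (x :: t).
have /tt'/sat_Ex[y yP] : sat (prep t e) (Ex theta) by apply/sat_Ex; exists x.
exists y; apply: same_typeW => phi xphi.
have /tt'/(_ y yP)// : sat (prep t e) (All (Imp theta phi)).
by move=> z zP; apply/(xI (z :: t)).
Qed.

(** Back-and-forth along the enumeration [g], run only in the forth direction; hence an embedding
    and not an isomorphism. *)
Lemma atomic_embedding (L : language) (A B : structure L) (g e : nat -> A)
    (e' : nat -> B) :
  (forall x, exists n, g n = x) -> atomic_over e -> same_type e e' ->
  exists h : A -> B, is_embedding h /\ h \o e = e'.
Proof.
move=> g_surj at_e ee'.
have /(_ _)/cid-/all_sig[y yP] (p : nat * seq B) : exists y,
    same_type (prep (tup g p.1) e) (prep p.2 e') ->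
    same_type (prep (tup g p.1.+1) e) (prep (y :: p.2) e').
  have [tt'|ntt'] := pselect (same_type (prep (tup g p.1) e) (prep p.2 e')).
    by have [y yP] := atomic_step (g p.1) at_e tt'; exists y.
  (* A default value, for pairs that do not have the same type. *)
  by exists (e' 0).
pose st := fix st n := if n is m.+1 then y (m, st m) :: st m else [::].
pose w n := y (n, st n).
have stE n : st n = tup w n by elim: n => //= n <-.
have wP n : same_type (prep (tup g n) e) (prep (tup w n) e').
  by elim: n => // n IH; have := yP (n, tup w n) IH; rewrite /= /w stE.
(* Moves variable [k] to the place of [g k] in the reversed tuple; variables from [n] on do not
   occur in [phi]. *)
pose sg n k := if k < n then n - k.+1 else n.
have gw : same_type g w.
  move=> phi; set n := fbound phi.
  have E (C : structure L) (v f : nat -> C) :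
      sat v phi <-> sat (prep (tup v n) f) (ren (sg n) phi).
    by rewrite sat_ren; apply: eq_sat => m mn /=; rewrite /sg mn prep_tup.
  by rewrite (E _ g e) (E _ w e') wP.
have [h [he hg]] : exists h : A -> B, is_embedding h /\ h \o g = w.
  by apply: diagram_embedding => // s t; exact: (gw (Eq s t)).
exists h; split=> //; apply/funext => i /=.
have [k gk] := g_surj (e i); rewrite -gk.
have -> : h (g k) = w k by rewrite -hg.
(* Equality of the newest entry with parameter [i] is a formula of the common type, so it passes
   from [g] and [e] to [w] and [e']. *)
have E (C : structure L) (v f : nat -> C) :
    sat (prep (tup v k.+1) f) (Eq (Var 0) (Var (k.+1 + i))) <-> v k = f i.
  by rewrite -(prep_ge (tup v k.+1) f i) size_tup.
exact/E/wP/E.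
Qed.

(** * Omitting types *)

(** The Rasiowa-Sikorski argument: step [n] meets the requirement numbered [n] by [f], if there is
    one, and otherwise keeps the condition. *)
Lemma generic_sequence (I P : Type) (f : I -> nat) (C : P -> Prop)
    (le : P -> P -> Prop) (D : I -> P -> Prop) (p0 : P) :
  injective f -> (forall p, le p p) -> C p0 ->
  (forall i p, C p -> exists q, [/\ C q, le q p & D i q]) ->
  exists s : nat -> P, [/\ forall n, C (s n), forall n, le (s n.+1) (s n) &
    forall i, exists n, D i (s n)].
Proof.
move=> f_inj le_refl Cp0 dense.
have /(_ _)/cid-/all_sig[g gP] (np : nat * P) : exists q,
    C np.2 -> [/\ C q, le q np.2 & forall i, f i = np.1 -> D i q].
  case: np => n p; have [[i fi]|nfi] := pselect (exists i, f i = n).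
    have [/(dense i)[q [Cq qp Dq]]|nCp] := pselect (C p); last by exists p.
    by exists q => _; split=> // k /=; rewrite -fi => /f_inj ->.
  by exists p => Cp; split=> // i fi; case: nfi; exists i.
pose s := fix s n := if n is m.+1 then g (m, s m) else p0.
have Cs n : C (s n) by elim: n => //= n /(gP (n, s n))[].
exists s; split=> // [n|i]; first by have [] := gP (n, s n) (Cs n).
by exists (f i).+1; have [_ _] := gP (f i, s (f i)) (Cs (f i)); apply.
Qed.

(* A definable ultrapower: [F] need only measure the first-order properties of
   the named points [ev k], and Los's theorem holds because [F_henkin] lets
   existential statements be witnessed by named points. *)
Section GenericModel.
Variables (L : language) (A : structure L) (Z : Type) (ev : Z -> nat -> A).
Variable F : (Z -> Prop) -> Prop.
Hypothesis F_sub : forall X Y : Z -> Prop, F X -> (forall z, X z -> Y z) -> F Y.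
Hypothesis F_all : forall n (X : 'I_n -> Z -> Prop),
  (forall i, F (X i)) -> F (fun z => forall i, X i z).
Hypothesis F_proper : ~ F (fun=> False).
Hypothesis F_decide : forall phi rho,
  F (fun z => sat (ev z \o rho) phi) \/ F (fun z => ~ sat (ev z \o rho) phi).
Hypothesis F_henkin : forall phi rho,
  F (fun z => ~ exists x, sat (scons x (ev z \o rho)) phi) \/
  exists k, F (fun z => sat (scons (ev z k) (ev z \o rho)) phi).

Lemma F_true (X : Z -> Prop) : (forall z, X z) -> F X.
Proof. by move=> XT; apply: F_sub (@F_all 0 (fun=> X) _) _ => // -[]. Qed.

Lemma F_and (X Y : Z -> Prop) : F X -> F Y -> F (fun z => X z /\ Y z).
Proof.
move=> FX FY.
have /F_all/F_sub : forall i : 'I_2, F (if i == 0 :> nat then X else Y).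
  by case=> -[|i].
apply=> z Xz; split; first exact: (Xz ord0).
exact: (Xz (lift ord0 ord0)).
Qed.

Lemma F_not (X : Z -> Prop) : F X -> F (fun z => ~ X z) -> False.
Proof.
by move=> FX /(F_and FX) FF; apply: F_proper; apply: F_sub FF _ => z [].
Qed.

Definition gen_eq (i j : nat) : bool := `[< F (fun z => ev z i = ev z j) >].

Lemma gen_eqP i j : reflect (F (fun z => ev z i = ev z j)) (gen_eq i j).
Proof. exact: asboolP. Qed.

Lemma gen_eq_refl : reflexive gen_eq.
Proof. by move=> i; apply/gen_eqP; apply: F_true. Qed.

Lemma gen_eq_sym : symmetric gen_eq.
Proof.
by move=> i j; apply/gen_eqP/gen_eqP => /F_sub; apply.
Qed.

Lemma gen_eq_trans : transitive gen_eq.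
Proof.
move=> j i k /gen_eqP ij /gen_eqP jk; apply/gen_eqP.
by apply: F_sub (F_and ij jk) _ => z [-> ->].
Qed.

Canonical gen_equiv := EquivRel gen_eq gen_eq_refl gen_eq_sym gen_eq_trans.

Definition gen_carrier := {eq_quot gen_equiv}%qT.

Definition gen_rep (x : gen_carrier) : nat := generic_quotient.repr x.

Definition gen_point (k : nat) : gen_carrier := (\pi_gen_carrier k)%qT.

Lemma gen_pointP i j :
  gen_point i = gen_point j <-> F (fun z => ev z i = ev z j).
Proof. by split=> [/eqmodP/gen_eqP|/gen_eqP/eqmodP]. Qed.

Lemma gen_repK (x : gen_carrier) : gen_point (gen_rep x) = x.
Proof. exact: reprK. Qed.

(** The Henkin property for the equation defining the function value; its existential closure always
    holds, which excludes the negative alternative. *)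
Lemma gen_fun_ex (f : Defs.fsym L) (a : 'I_(farity f) -> nat) :
  exists k, F (fun z => ev z k = finterp (fun i => ev z (a i))).
Proof.
have [Fn|//] := F_henkin (Eq (Var 0) (App (fun i => Var (a i).+1))) id.
case: (F_not Fn); apply: F_true => z; case.
by exists (finterp (fun i => ev z (a i))).
Qed.

Definition gen_structure : structure L :=
  @Structure L gen_carrier (inhabits (gen_point 0))
    (fun f a =>
       gen_point (projT1 (cid (gen_fun_ex (fun i => gen_rep (a i))))))
    (fun r a => F (fun z => rinterp (fun i => ev z (gen_rep (a i))))).

Lemma gen_eval (rho : nat -> nat) t k :
  eval (M := gen_structure) (gen_point \o rho) t = gen_point k <->
  F (fun z => eval (ev z \o rho) t = ev z k).
Proof.
elim: t k => [m|f a IH] k; first exact: gen_pointP.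
pose b i := gen_rep (eval (M := gen_structure) (gen_point \o rho) (a i)).
have bE : F (fun z => (fun i => eval (ev z \o rho) (a i)) =
                      (fun i => ev z (b i))).
  (* Finitely many arguments: closure of [F] under finite intersections makes all the equalities
     hold at once. *)
  have /F_all : forall i, F (fun z => eval (ev z \o rho) (a i) = ev z (b i)).
    by move=> i; apply/IH; rewrite gen_repK.
  by move=> /F_sub; apply=> z E; apply/funext.
rewrite /= -/b; case: cid => j /= jP; rewrite gen_pointP.
split=> H; apply: F_sub (F_and H (F_and jP bE)) _ => z [+ [jE abE]].
  by rewrite abE -jE => <-.
by rewrite abE -jE => <-.
Qed.

Lemma gen_sat (rho : nat -> nat) phi :
  sat (M := gen_structure) (gen_point \o rho) phi <->
  F (fun z => sat (ev z \o rho) phi).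
Proof.
elim: phi rho => //= [s t|r a|p IHp q IHq|p IH] rho.
- pose k := gen_rep (eval (M := gen_structure) (gen_point \o rho) t).
  have tk : eval (M := gen_structure) (gen_point \o rho) t = gen_point k.
    by rewrite gen_repK.
  rewrite tk gen_eval; move/gen_eval: tk => tk.
  by split=> H; apply: F_sub (F_and H tk) _ => z [-> ->].
- pose b i := gen_rep (eval (M := gen_structure) (gen_point \o rho) (a i)).
  have bE : F (fun z => (fun i => eval (ev z \o rho) (a i)) =
                        (fun i => ev z (b i))).
    have /F_all : forall i, F (fun z => eval (ev z \o rho) (a i) = ev z (b i)).
      by move=> i; apply/gen_eval; rewrite gen_repK.
    by move=> /F_sub; apply=> z E; apply/funext.
  by split=> H; apply: F_sub (F_and H bE) _ => z [+ abE]; rewrite /= abE.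
- rewrite IHp IHq; split=> [pq|Fpq Fp].
    (* The ultrafilter property, restricted to definable sets, settles implication. *)
    have [/pq Fq|Fnp] := F_decide p rho; first exact: F_sub Fq _.
    by apply: F_sub Fnp _ => z np /np.
  by apply: F_sub (F_and Fpq Fp) _ => z [/[apply]].
- split=> [H|H x].
    have [Fn|[k Fk]] := F_henkin (Not p) rho.
      apply: F_sub Fn _ => z nex x; apply: contrapT => nx.
      by apply: nex; exists x.
    have := H (gen_point k); rewrite -comp_scons => /IH Fp.
    by case: (F_not Fp); apply: F_sub Fk _ => z; rewrite comp_scons.
  rewrite -(gen_repK x) -comp_scons; apply/IH; apply: F_sub H _ => z Hz.
  by rewrite comp_scons; exact: Hz.
Qed.

Lemma generic_model : exists (B : structure L) (c : nat -> B),
  (forall b, exists k, c k = b) /\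
  forall rho phi, sat (c \o rho) phi <-> F (fun z => sat (ev z \o rho) phi).
Proof.
exists gen_structure, gen_point; split=> [b|]; last exact: gen_sat.
by exists (gen_rep b); exact: gen_repK.
Qed.

End GenericModel.

(* Even variables denote the parameters [e], odd ones the Henkin constants. *)
Definition mix (X : Type) (e z : nat -> X) (k : nat) : X :=
  if odd k then z k./2 else e k./2.

Lemma comp_mix (X Y : Type) (h : X -> Y) e z :
  h \o mix e z = mix (h \o e) (h \o z).
Proof. by apply/funext => k; rewrite /mix /=; case: odd. Qed.

Lemma mix_double (X : Type) (e z : nat -> X) : mix e z \o double = e.
Proof. by apply/funext => k; rewrite /mix /= odd_double doubleK. Qed.

Lemma eq_mix (X : Type) (e z z' : nat -> X) n :
  (forall k, k < n -> z k = z' k) -> forall k, k < n -> mix e z k = mix e z' k.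
Proof.
move=> zz k kn; rewrite /mix; case: ifP => // _; apply: zz.
apply: leq_ltn_trans kn.
by rewrite -{2}(odd_double_half k) -addnn addnCA leq_addr.
Qed.

(** * Forcing conditions and dense requirements *)

Section OmittingTypes.
Variables (L : language) (A : structure L) (e : nat -> A) (tt : nat -> seq A).
Hypothesis L_countable : countable_language L.

(** Conditions are formulas about the parameters and finitely many Henkin constants. They are tested
    on the assignments [z] of elements of [A] to these constants. *)
Definition forces (p : formula L) (X : (nat -> A) -> Prop) :=
  forall z, sat (mix e z) p -> X z.

Definition consistent (p : formula L) := exists z, sat (mix e z) p.

(* [theta] quantifies the first [n] odd variables existentially; [sg] moves the
   even variables to the parameters and the odd variables below [2 n] to the
   quantified ones.  The odd variables beyond that do not occur in [p] or [u]. *)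
Lemma realized_definable (p : formula L) (u : seq nat) :
  exists theta, forall t', size t' = size u ->
    (sat (prep t' e) theta <->
     exists z, sat (mix e z) p /\ map (mix e z) u = t').
Proof.
pose n := maxn (fbound p) (\max_(k <- u) k.+1).
pose od i := if i < n then i else n.
pose sg := mix (fun i => n + (size u + i)) od.
(* Past the [n] quantified variables, the indices [iota n (size u)] are those of the entries of
   [t']. *)
exists (iter n (@Ex L) (And (ren sg p) (eqs L (map sg u) (iota n (size u))))).
move=> t' st'; rewrite sat_iter_Ex.
have body xs : size xs = n ->
    sat (prep xs (prep t' e))
      (And (ren sg p) (eqs L (map sg u) (iota n (size u))))
    <-> sat (mix e (prep xs (prep t' e) \o od)) p
     /\ map (mix e (prep xs (prep t' e) \o od)) u = t'.
  move=> sxs; rewrite sat_And sat_ren sat_eqs ?size_map ?size_iota//.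
  rewrite -map_comp.
  have -> : prep xs (prep t' e) \o sg =
      mix e (prep xs (prep t' e) \o od).
    rewrite comp_mix; congr mix; apply/funext => i /=.
    by rewrite -sxs prep_ge -st' prep_ge.
  have -> // : map (prep xs (prep t' e)) (iota n (size u)) = t'.
  apply: (@eq_from_nth _ (e 0)); rewrite size_map size_iota// => i iu.
  rewrite (nth_map 0) ?size_iota// nth_iota// -sxs prep_ge (prep_lt (e 0))//.
  by rewrite st'.
split=> [[xs [sxs /body-/(_ sxs) H]]|[z [zp zu]]]; first by eexists; exact: H.
exists (mkseq z n); split; first exact: size_mkseq.
apply/body; first exact: size_mkseq.
(* Truncating [z] is harmless: only variables below [n] occur in [p] and [u], and they read [z]
   below [n]. *)
have E k : k < n ->
    mix e (prep (mkseq z n) (prep t' e) \o od) k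
    = mix e z k.
  apply: eq_mix => {}k kn /=; rewrite /od kn (prep_lt (e 0)) ?size_mkseq//.
  by rewrite nth_mkseq.
split; first by apply: (eq_sat _).2 zp => m mp; apply: E; rewrite leq_max mp.
rewrite -[RHS]zu; apply/eq_in_map => k ku; apply: (E k).
by rewrite leq_max (@leq_bigmax_seq _ u xpredT S k ku isT) orbT.
Qed.

(* [inl (inl phi)] decides [phi], [inl (inr phi)] provides a Henkin witness for
   [phi], and [inr (m, u)] keeps the constants [u] from realizing the type of
   [tt m] unless this type is isolated. *)
Definition requirement : Type := formula L + formula L + nat * seq nat.

Definition omits (t : seq A) (u : seq nat) (p : formula L) :=
  size u = size t -> isolated e t \/
  exists phi, ~ sat (prep t e) phi /\
    forces p (fun z => sat (prep (map (mix e z) u) e) phi).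

Definition meets (R : requirement) (p : formula L) : Prop :=
  match R with
  | inl (inl phi) => forces p (fun z => sat (mix e z) phi) \/
                     forces p (fun z => ~ sat (mix e z) phi)
  | inl (inr phi) =>
      forces p (fun z => ~ exists x, sat (scons x (mix e z)) phi) \/
      exists k, forces p (fun z => sat (scons (mix e z k) (mix e z)) phi)
  | inr (m, u) => omits (tt m) u p
  end.

Lemma dense_decide p phi : consistent p ->
  exists q, [/\ consistent q, forces q (fun z => sat (mix e z) p) &
                meets (inl (inl phi)) q].
Proof.
move=> [z zp]; have [zphi|nphi] := pselect (sat (mix e z) phi).
  exists (And p phi); split; first by exists z; apply/sat_And.
    by move=> w /sat_And[].
  by left=> w /sat_And[].
exists (And p (Not phi)); split; first by exists z; apply/sat_And.
  by move=> w /sat_And[].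
by right=> w /sat_And[].
Qed.

Lemma dense_henkin p phi : consistent p ->
  exists q, [/\ consistent q, forces q (fun z => sat (mix e z) p) &
                meets (inl (inr phi)) q].
Proof.
move=> p_con.
have [[z [zp [x xphi]]]|nex] := pselect (exists z, sat (mix e z) p /\
    exists x, sat (scons x (mix e z)) phi); last first.
  by exists p; split=> //; left=> z zp xP; apply: nex; exists z.
(* A fresh Henkin constant: changing [z] at [j] affects no variable of [p] or [phi]. *)
pose j := maxn (fbound p) (fbound phi); pose k := j.*2.+1.
have mixk z' : mix e z' k = z' j by rewrite /mix /k /= odd_double uphalf_double.
exists (And p (ren (scons k id) phi)); split; last 2 first.
- by move=> w /sat_And[].
- by right; exists k => w /sat_And[_]; rewrite sat_ren comp_scons.
pose z' i := if i == j then x else z i; exists z'.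
have z'j : z' j = x by rewrite /z' eqxx.
have E m : m < j -> mix e z m = mix e z' m.
  by apply: eq_mix => i ij; rewrite /z' ltn_eqF.
apply/sat_And; rewrite sat_ren comp_scons mixk z'j; split.
  by apply: (eq_sat _).1 zp => m mp; apply: E; rewrite leq_max mp.
apply: (eq_sat _).1 xphi => -[|m] //= mp.
by apply: E; rewrite leq_max (ltnW mp) orbT.
Qed.

Lemma dense_omit p t u : consistent p ->
  exists q, [/\ consistent q, forces q (fun z => sat (mix e z) p) &
    omits t u q].
Proof.
move=> [z0 z0p]; have [ut|nut] := pselect (size u = size t); last first.
  by exists p; split=> //; exists z0.
have [it|nit] := pselect (isolated e t).
  by exists p; split=> //; [exists z0|left].
have [[z [phi [zp zphi nphi]]]|nex] := pselect (exists z phi,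
    [/\ sat (mix e z) p, sat (prep (map (mix e z) u) e) phi &
        ~ sat (prep t e) phi]).
  (* [prep u double] turns tuple entries into the variables [u] and parameter [i] into the even
     variable denoting it. *)
  have E w : prep (map (mix e w) u) e = mix e w \o prep u double.
    by rewrite comp_prep mix_double.
  exists (And p (ren (prep u double) phi)); split.
  - by exists z; apply/sat_And; rewrite sat_ren -E.
  - by move=> w /sat_And[].
  - move=> _; right; exists phi; split=> // w /sat_And[_].
    by rewrite sat_ren -E.
(* Every realization of [p] on [u] now has the type of [t], so a formula
   defining the set of these realizations isolates that type. *)
have [theta thetaP] := realized_definable p u.
have p_type z :
    sat (mix e z) p -> same_type (prep (map (mix e z) u) e) (prep t e).
  move=> zp; apply: same_typeW => phi zphi; apply: contrapT => nphi.
  by apply: nex; exists z, phi.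
case: nit; exists theta; split.
  by apply/(p_type _ z0p)/thetaP; rewrite ?size_map//; exists z0.
move=> t' st'; rewrite -ut in st'; move=> /thetaP-/(_ st')[z [zp <-]].
exact/same_type_sym/p_type.
Qed.

(** The properties forced along a generic sequence of conditions form a filter as required for the
    generic model. That model is enumerated by [c], so the lemma also serves as a downward
    Löwenheim-Skolem theorem. *)
Lemma omitting_types : exists (B : structure L) (e' c : nat -> B),
  [/\ same_type e e', forall b, exists k, c k = b &
    forall m u, size u = size (tt m) ->
      same_type (prep (tt m) e) (prep u e') -> isolated e (tt m)].
Proof.
have [cd cd_inj] := formula_code L_countable.
pose rc (R : requirement) : nat := pickle (match R with
  | inl (inl phi) => inl (inl (cd phi))
  | inl (inr phi) => inl (inr (cd phi))
  | inr mu => inr mu end : nat + nat + nat * seq nat).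
have rc_inj : injective rc.
  apply: inj_comp; first exact: pcan_inj pickleK.
  by move=> [[p|p]|mu] [[q|q]|nu] //= [] => [/cd_inj->|/cd_inj->|->].
have [s [s_con s_dec s_meets]] := @generic_sequence requirement (formula L) rc
  consistent (fun q p => forces q (fun z => sat (mix e z) p)) meets (Not Bot)
  rc_inj (fun p z => id) (ex_intro _ e id) (fun R p => match R with
    | inl (inl phi) => dense_decide phi
    | inl (inr phi) => dense_henkin phi
    | inr (m, u) => dense_omit (tt m) u end).
have s_le m n : m <= n -> forces (s n) (fun z => sat (mix e z) (s m)).
  elim: n => [|n IH]; first by rewrite leqn0 => /eqP -> z.
  rewrite leq_eqVlt => /predU1P[-> z //|]; rewrite ltnS => /IH H z /s_dec.
  exact: H.
pose F X := exists n, forces (s n) X.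
have F_sub (X Y : (nat -> A) -> Prop) : F X -> (forall z, X z -> Y z) -> F Y.
  by move=> [n nX] XY; exists n => z /nX/XY.
have F_all n (X : 'I_n -> (nat -> A) -> Prop) :
    (forall i, F (X i)) -> F (fun z => forall i, X i z).
  (* Conditions grow stronger with the index, so the largest index forces all the [X i]. *)
  move=> /(_ _)/cid-/all_sig[k kP]; exists (\max_i k i) => z zs i.
  apply: (kP i); apply: s_le zs; exact: leq_bigmax.
have F_proper : ~ F (fun=> False) by move=> [n nF]; have [z /nF] := s_con n.
have F_decide phi rho : F (fun z => sat (mix e z \o rho) phi) \/
    F (fun z => ~ sat (mix e z \o rho) phi).
  by have [n [H|H]] := s_meets (inl (inl (ren rho phi))); [left|right];
    exists n => z /H; rewrite sat_ren.
have F_henkin phi rho :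
    F (fun z => ~ exists x, sat (scons x (mix e z \o rho)) phi) \/
    exists k, F (fun z => sat (scons (mix e z k) (mix e z \o rho)) phi).
  have E x z : sat (scons x (mix e z)) (ren (scons 0 (S \o rho)) phi) <->
      sat (scons x (mix e z \o rho)) phi by rewrite sat_ren comp_scons.
  have [n [H|[k H]]] := s_meets (inl (inr (ren (scons 0 (S \o rho)) phi))).
    by left; exists n => z /H nex [x /E xP]; apply: nex; exists x.
  by right; exists k, n => z /H/E.
have [B [c [c_surj cP]]] :=
  generic_model F_sub F_all F_proper F_decide F_henkin.
exists B, (c \o double), c; split.
- apply: same_typeW => phi ephi; apply/cP; exists 0 => z _.
  by rewrite mix_double.
- exact: c_surj.
(* Name [u0] by constants [u]. Unless [tt m] is isolated, the requirement for [m] and [u] forced a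
   formula true of [u0] and false of [tt m]. *)
move=> m u0 su0 tu; have [u uE] : exists u, map c u = u0.
  elim: u0 {su0 tu} => [|b u0 [u <-]]; first by exists [::].
  by have [k <-] := c_surj b; exists (k :: u).
have [n] := s_meets (inr (m, u)); case; first by rewrite -su0 -uE size_map.
  by [].
move=> [phi [nphi H]]; case: nphi; apply/tu; rewrite -uE -comp_prep.
apply/cP; exists n => z /H; by rewrite comp_prep mix_double.
Qed.

End OmittingTypes.

(** * Enumerations and the construction of the closure *)

Lemma enumeration (X : Type) (f : X -> nat) :
  inhabited X -> injective f ->
  exists e : nat -> X, forall x, exists n, e n = x.
Proof.
move=> [x0] f_inj.
have /(_ _)/cid-/all_sig[e eP] (n : nat) : exists y, forall x, f x = n -> y = x.
  have [[x <-]|nex] := pselect (exists x, f x = n).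
    by exists x => y /f_inj.
  by exists x0 => x fx; case: nex; exists x.
by exists e => x; exists (f x); exact: eP.
Qed.

(** The type of [i \o e] contains the atomic diagram of [N], which [e'] therefore satisfies. *)
Lemma embedding_same_type (L : language) (N A B : structure L) (e : nat -> N)
    (i : N -> A) (e' : nat -> B) :
  (forall x, exists n, e n = x) -> is_embedding i -> same_type (i \o e) e' ->
  exists j : N -> B, is_embedding j /\ j \o e = e'.
Proof.
move=> e_surj ie ie'; have [i_inj _ ir] := ie; apply: diagram_embedding => //.
  move=> s t; rewrite -[X in _ <-> X](ie' (Eq s t)) /= -!eval_embedding//.
  by split=> [->|/i_inj].
move=> r a; rewrite -ie' /= ir.
have -> // : (fun k => i (eval e (a k))) = (fun k => eval (i \o e) (a k)).
by apply/funext => k; rewrite eval_embedding.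
Qed.

(** Both types are that of the same sequence in the common elementary submodel. *)
Lemma SS_same_type (L : language) (T : theory L) (N A B : structure L)
    (i : N -> A) (j : N -> B) (e : nat -> N) :
  SS_property T -> models A T -> models B T -> is_embedding i ->
  is_embedding j -> same_type (i \o e) (j \o e).
Proof.
move=> SS AT BT ie je.
have [C [c [a [b [_ [_ aE] bE <- <-]]]]] := SS_amalgam SS AT BT ie je.
exact: same_type_trans (same_type_sym (aE (c \o e))) (bE (c \o e)).
Qed.

Theorem theorem3p8 (L : language) (T : theory L)
    (L_countable : countable_language L) (T_SS : SS_property T)
    (M : structure L) (M_model : models M T)
    (N : substructure M) (N_countable : countable (N : set M)) :
  has_T_closure T (induced N).
Proof.
have [e e_surj] : exists e : nat -> induced N, forall x, exists n, e n = x.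
  have [f f_inj] := countable_injP _ N_countable.
  apply: (@enumeration _ (f \o val)).
    exact: (carrier_nonempty (induced N)).
  by move=> x y /= /f_inj xy; apply/val_inj/xy; exact: valP.
(* Only the empty tuple is listed here: the aim is a countable model [M1]. *)
have [M1 [e1 [c1 [tp1 c1_surj _]]]] :=
  omitting_types (@Defs.incl _ _ N \o e) (fun=> [::]) L_countable.
have [i1 [i1_emb i1e]] :=
  embedding_same_type e_surj (@embedding_incl _ _ N) tp1.
have M1T := models_same_type tp1 M_model.
(* Lists all tuples of [M1] through codes of their index sequences; numbers that code none give the
   empty tuple. *)
pose tt m := map c1 (odflt [::] (unpickle m : option (seq nat))).
have [M2 [e2 [c2 [tp2 _ omit]]]] := omitting_types e1 tt L_countable.
have M2T := models_same_type tp2 M1T.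
rewrite -i1e in tp2.
have [i2 [i2_emb i2e]] := embedding_same_type e_surj i1_emb tp2.
have [C [c [a [b [CT [c_emb a_el] b_el aE bE]]]]] :=
  SS_amalgam T_SS M1T M2T i1_emb i2_emb.
(* A tuple [t] of [C] has the same type as [map a t] in [M1] and as [map b t] in [M2]. Being
   realized in [M2], this type is isolated in [M1], hence in [C]. *)
have C_atomic : atomic_over (c \o e).
  move=> t; apply: (isolated_elementary a_el).
  have [u uE] : exists u, map c1 u = map a t.
    elim: t => [|x t [u IH]]; first by exists [::].
    by have [k ck] := c1_surj (a x); exists (k :: u); rewrite /= ck IH.
  have ttE : tt (pickle u) = map a t by rewrite /tt pickleK.
  have aeE : a \o (c \o e) = e1 by rewrite compA aE.
  have beE : b \o (c \o e) = e2 by rewrite compA bE.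
  rewrite aeE -ttE; apply: (omit _ (map b t)); rewrite ttE ?size_map//.
  rewrite -aeE -beE -!comp_prep.
  exact: same_type_trans (same_type_sym (a_el _)) (b_el _).
have [g g_surj] : exists g : nat -> C, forall x, exists n, g n = x.
  have /(_ _)/cid-/all_sig[k kP] := c1_surj.
  (* [C] is countable because [a] injects it into [M1]. *)
  apply: (@enumeration _ (k \o a)); first exact: carrier_nonempty.
  by apply: inj_comp (elementary_map_inj a_el) => x y kxy; rewrite -(kP x) kxy.
exists C, c; split=> // B j BT j_emb.
have [h [h_emb hE]] := atomic_embedding g_surj C_atomic
  (SS_same_type e T_SS CT BT c_emb j_emb).
exists h; split=> // x; have [n <-] := e_surj x.
exact: (congr1 (fun f => f n) hE).
Qed.
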